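(* Let $Q$ be a quantale with $\mathcal J(Q)=\theta$, and let $\Sigma_Q$ be a class of proper ideals of $Q$ containing all maximal ideals of $Q$. If the closed subbasis $\mathcal S=\{X^{\uparrow}\mid X\subseteq\mathcal I_Q\}$ of the quantale space $\Sigma_Q$ strongly disconnects $\Sigma_Q$, then $Q$ has a non-trivial idempotent element, i.e. there is $e\in Q$ with $e\& e=e$ and $e\neq\bot$, $e\neq\top$.
   Context: A quantale here means a complete lattice $(Q,\preccurlyeq,\bot,\top)$ with a binary operation $\&$ that is associative, commutative, satisfies $x\&\bigl(\bigvee_{\lambda} y_\lambda\bigr)=\bigvee_\lambda (x\& y_\lambda)$ for all families, and satisfies $x\&\top=x$ for all $x$. An ideal of $Q$ is a nonempty subset $I\subseteq Q$ such that $x,y\in I$ implies $x\vee y\in I$, and $x\in I$, $l\preccurlyeq x$ imply $l\in I$. $\mathcal I_Q$ is the set of all ideals of $Q$ and $\theta=\{\bot\}$ is the zero ideal. An ideal is proper if $I\neq Q$; a maximal ideal is a proper ideal not properly contained in any other proper ideal. The Jacobson radical $\mathcal J(Q)$ is the intersection of all maximal ideals of $Q$. For a set $\Sigma_Q$ of proper ideals of $Q$ and $X\subseteq \mathcal I_Q$, put $X^{\uparrow}=\{J\in\Sigma_Q\mid \bigcap X\subseteq J\}$ if $X\neq\emptyset$ and $\emptyset^{\uparrow}=\emptyset$. The quantale topology on $\Sigma_Q$ is the topology having the sets $X^{\uparrow}$ ($X\subseteq \mathcal I_Q$) as a subbasis of closed sets; $\Sigma_Q$ with this topology is called a quantale space.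 A closed subbasis $\mathcal S$ of a topological space $Y$ strongly disconnects $Y$ if there exist non-empty sets $A,B\in\mathcal S$ with $Y=A\cup B$ and $A\cap B=\emptyset$. *)

(* Defs.v *)
From HB Require Import structures.
From mathcomp Require Import all_boot all_order finmap.
From mathcomp Require Import all_classical.
From mathcomp Require Import topology_structure.

Set Implicit Arguments.
Unset Strict Implicit.
Unset Printing Implicit Defensive.

Import Order.TTheory.
Local Open Scope classical_set_scope.

HB.mixin Record isCompleteLattice (d : Order.disp_t) (Q : Type)
    & Order.TBLattice d Q := {
  bigsup : set Q -> Q;
  bigsupP : forall A : set Q, supremums A (bigsup A)
}.

#[short(type="completeLatticeType")]
HB.structure Definition CompleteLattice (d : Order.disp_t) :=
  {Q of isCompleteLattice d Q & Order.TBLattice d Q}.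

HB.mixin Record isQuantale (d : Order.disp_t) (Q : Type)
    & CompleteLattice d Q := {
  qmul : Q -> Q -> Q;
  qmulA : associative qmul;
  qmulC : commutative qmul;
  qmul_bigsup : forall (x : Q) (A : set Q),
    qmul x (bigsup A) = bigsup [set qmul x y | y in A];
  qmul1 : forall x : Q, qmul x (\top)%O = x
}.

#[short(type="quantaleType")]
HB.structure Definition Quantale (d : Order.disp_t) :=
  {Q of isQuantale d Q & CompleteLattice d Q}.

Section Ideals.
Context (d : Order.disp_t) (Q : quantaleType d).
Implicit Types I J M : set Q.

Definition ideal : set (set Q) := [set I |
  [/\ I !=set0,
      forall x y, I x -> I y -> I (x `|` y)%O
    & forall x l, I x -> (l <= x)%O -> I l]].

Definition zero_ideal : set Q := [set (\bot)%O].

Definition proper_ideal : set (set Q) := [set I | ideal I /\ I <> setT].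

Definition maximal_ideal : set (set Q) := [set M |
  proper_ideal M /\ forall J, proper_ideal J -> M `<=` J -> M = J].

(* The intersection is [setT] when there is no maximal ideal. *)
Definition jacobson_radical : set Q := \bigcap_(M in maximal_ideal) M.

End Ideals.

Arguments ideal {d} Q.
Arguments zero_ideal {d} Q.
Arguments proper_ideal {d} Q.
Arguments maximal_ideal {d} Q.
Arguments jacobson_radical {d} Q.

(* The points are the elements of [Sigma]; [Sigma] is meant to be a set of
   proper ideals. *)
Definition quantale_space (d : Order.disp_t) (Q : quantaleType d)
  (Sigma : set (set Q)) : Type := set_type Sigma.

HB.instance Definition _ d (Q : quantaleType d) (Sigma : set (set Q)) :=
  Choice.on (quantale_space Sigma).

Section QuantaleTopology.
Context (d : Order.disp_t) (Q : quantaleType d) (Sigma : set (set Q)).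

Definition uparrow (X : set (set Q)) : set (quantale_space Sigma) :=
  [set J | X !=set0 /\ \bigcap_(I in X) I `<=` set_val J].

Definition quantale_subbasis : set (set (quantale_space Sigma)) :=
  [set uparrow X | X in [set X | X `<=` ideal Q]].

HB.instance Definition _ :=
  isSubBaseTopological.Build (quantale_space Sigma) quantale_subbasis
    (@setC (quantale_space Sigma)).

End QuantaleTopology.

Arguments uparrow {d Q} Sigma X.
Arguments quantale_subbasis {d Q} Sigma.

Definition closed_subbasis (Y : topologicalType) (S : set (set Y)) : Prop :=
  S `<=` closed /\
  forall C : set Y, closed C -> exists2 F : set {fset set Y},
    (forall D, F D -> [set` D] `<=` S) &
    C = \bigcap_(D in F) \bigcup_(B in [set` D]) B.

Definition strongly_disconnects (Y : topologicalType) (S : set (set Y)) : Prop :=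
  exists A B : set Y,
    [/\ S A /\ S B, A !=set0, B !=set0, A `|` B = setT & A `&` B = set0].

Lemma quantale_closed_subbasis (d : Order.disp_t) (Q : quantaleType d)
    (Sigma : set (set Q)) :
  closed_subbasis (quantale_subbasis Sigma).
Proof.
split=> [_ [X sX <-]|C].
  rewrite -openC; exists [set ~` uparrow Sigma X]; last by rewrite bigcup_set1.
  by move=> _ ->; apply: finI_from1; exists X.
rewrite -openC; case=> G sG GC.
exists [set D : {fset set (quantale_space Sigma)} |
  [set` D] `<=` quantale_subbasis Sigma /\
  G (\bigcap_(B in [set` D]) ~` B)]; first by move=> D [].
rewrite -[LHS]setCK -GC; apply/seteqP; split=> J.
  move=> nJ D; case=> [_ GD]; rewrite -[X in X J]setCK setC_bigcup => DJ.
  by apply: nJ; exists (\bigcap_(B in [set` D]) ~` B).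
move=> FJ [U GU UJ]; have [D sD DU] := sG _ GU.
have [|B DB BJ] := FJ D.
  by split=> [B /sD /set_mem//|]; rewrite DU.
by move: UJ; rewrite -DU => /(_ _ DB).
Qed.

(* Main.v *)
(* Write the two closed sets as the ideals containing [I], respectively [K],
   where [I] and [K] are intersections of ideals.  Since no member of [Sigma],
   hence no maximal ideal, contains both, the ideal generated by [I] and [K]
   is everything, so [x `|` y = \top] for some [x] in [I] and [y] in [K].
   Since each maximal ideal contains [I] or [K], [x & y] lies in the Jacobson
   radical, so [x & y = \bot] and [x = x & (x `|` y) = x & x]. *)
Require Import Defs.
From mathcomp Require Import all_boot all_order.
From mathcomp Require Import all_classical.
From mathcomp Require Import topology_structure.

Local Open Scope classical_set_scope.

Import Order.TTheory.

Section QuantaleIdeals.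
Context {d : Order.disp_t} {Q : quantaleType d}.
Implicit Types (x y z : Q) (I J K : set Q) (X : set (set Q)).

Lemma bigsup2 x y : bigsup [set x; y] = (x `|` y)%O.
Proof.
have [ub lub] := bigsupP [set x; y].
apply/le_anti/andP; split.
  by apply: lub => _ [->|->]; rewrite ?leUl ?leUr.
by rewrite leUx !ub //; [right|left].
Qed.

Lemma qmulUr x y z : qmul x (y `|` z)%O = (qmul x y `|` qmul x z)%O.
Proof. by rewrite -!bigsup2 qmul_bigsup image_setU !image_set1. Qed.

(** Write [x] as [qmul x \top]: then [qmul x y] is absorbed in the join because [y] joined with
    [\top] is [\top]. *)
Lemma qmul_lel x y : (qmul x y <= x)%O.
Proof. by rewrite leEjoin -{2 3}(qmul1 x) -qmulUr joinx1. Qed.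

Lemma qmul_ler x y : (qmul x y <= y)%O.
Proof. by rewrite qmulC qmul_lel. Qed.

Lemma ideal_bot {I} : ideal Q I -> I (\bot)%O.
Proof. by case=> -[x Ix] _ /(_ _ _ Ix); apply; exact: le0x. Qed.

Lemma ideal_top {I} : ideal Q I -> I (\top)%O -> I = setT.
Proof.
by case=> _ _ Idown I1; apply/seteqP; split=> // x _; exact: Idown (lex1 x).
Qed.

Lemma proper_ideal_top {I} : proper_ideal Q I -> ~ I (\top)%O.
Proof. by case=> iI nI /(ideal_top iI). Qed.

Lemma ideal_bigcap X : X `<=` ideal Q -> ideal Q (\bigcap_(I in X) I).
Proof.
move=> sX; split.
- by exists (\bot)%O => I /sX /ideal_bot.
- by move=> x y Ix Iy I XI; have [_ + _] := sX _ XI; apply; [exact: Ix|exact: Iy].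
- by move=> x l Ix lx I XI; have [_ _ +] := sX _ XI; apply; [exact: Ix|].
Qed.

(** The ideal generated by [I] and [K]. The inequality is needed since [Q] may fail to be
    distributive, so the bare joins need not form a down-set. *)
Definition ideal_join I K : set Q :=
  [set z | exists x y, [/\ I x, K y & (z <= x `|` y)%O]].

Lemma ideal_joinP I K : ideal Q I -> ideal Q K -> ideal Q (ideal_join I K).
Proof.
move=> iI iK; have [_ IU _] := iI; have [_ KU _] := iK; split.
- exists (\bot)%O; exists (\bot)%O, (\bot)%O.
  by split; [exact: ideal_bot|exact: ideal_bot|exact: le0x].
- move=> z z' [x [y [Ix Ky zxy]]] [x' [y' [Ix' Ky' zxy']]].
  exists (x `|` x')%O, (y `|` y')%O; split; [exact: IU|exact: KU|].
  by rewrite joinACA leU2.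
- move=> z l [x [y [Ix Ky zxy]]] lz; exists x, y; split=> //.
  exact: le_trans zxy.
Qed.

Lemma sub_ideal_joinl I K : ideal Q K -> I `<=` ideal_join I K.
Proof.
by move=> iK x Ix; exists x, (\bot)%O; split; [|exact: ideal_bot|exact: leUl].
Qed.

Lemma sub_ideal_joinr I K : ideal Q I -> K `<=` ideal_join I K.
Proof.
by move=> iI y Ky; exists (\bot)%O, y; split; [exact: ideal_bot| |exact: leUr].
Qed.

(** Zorn's lemma applies because a proper ideal is one that misses [\top], a property that survives
    unions of chains. *)
Lemma exists_maximal_ideal I : proper_ideal Q I ->
  exists2 M, maximal_ideal Q M & I `<=` M.
Proof.
move=> pI; have [iI _] := pI.
(* The empty set is admitted in [P] because [Zorn_bigcup] also takes the union
   of the empty chain. *)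
pose P : set (set Q) := [set J | J !=set0 -> proper_ideal Q J /\ I `<=` J].
have [F sF totF|M [PM maxM]] := @Zorn_bigcup Q P.
  move=> [x0 [J0 FJ0 J0x0]].
  have PF J x : F J -> J x -> proper_ideal Q J /\ I `<=` J.
    by move=> FJ Jx; apply: sF FJ _; exists x.
  have [_ sIJ0] := PF _ _ FJ0 J0x0.
  split; last by move=> x Ix; exists J0 => //; exact: sIJ0.
  split; last first.
    move=> FT; have : (\bigcup_(J in F) J) (\top)%O by rewrite FT.
    by case=> J FJ J1; have [/proper_ideal_top] := PF _ _ FJ J1.
  split; first by exists x0, J0.
  - move=> x y [J FJ Jx] [J' FJ' J'y].
    have [[[_ JU _] _] _] := PF _ _ FJ Jx.
    have [[[_ J'U _] _] _] := PF _ _ FJ' J'y.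
    have [sJ|sJ] := totF _ _ FJ FJ'.
      by exists J' => //; apply: J'U => //; exact: sJ.
    by exists J => //; apply: JU => //; exact: sJ.
  - move=> x l [J FJ Jx] lx; have [[[_ _ Jdown] _] _] := PF _ _ FJ Jx.
    by exists J => //; exact: Jdown lx.
(* Were [M] empty, [I] would be a strictly larger member of [P]. *)
have M0 : M !=set0.
  apply/set0P/negP => /eqP M0; apply: (maxM I); last by move=> _; split.
  rewrite M0; split=> // sI0; exact: sI0 (ideal_bot iI).
have [pM sIM] := PM M0; exists M => //; split=> // J pJ sMJ.
apply/seteqP; split=> //; apply: contrapT => nJM.
by apply: (maxM J) => // _; split=> //; exact: subset_trans sMJ.
Qed.

(** A proper [ideal_join I K] would lie in a maximal ideal, which would then contain both [I] and
    [K]. *)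
Lemma comaximal_ideals I K : ideal Q I -> ideal Q K ->
  (forall M, maximal_ideal Q M -> I `<=` M -> K `<=` M -> False) ->
  exists x y, [/\ I x, K y & (x `|` y)%O = (\top)%O].
Proof.
move=> iI iK nIK; have [IKT|nT] := pselect (ideal_join I K = setT).
  have : ideal_join I K (\top)%O by rewrite IKT.
  by case=> x [y [Ix Ky]]; rewrite le1x => /eqP xy; exists x, y.
have [//|M mM sM] := @exists_maximal_ideal (ideal_join I K).
  by split=> //; exact: ideal_joinP.
exfalso; apply: nIK mM _ _; apply: subset_trans sM.
- exact: sub_ideal_joinl.
- exact: sub_ideal_joinr.
Qed.

Lemma complemented_idempotent x y :
  (x `|` y)%O = (\top)%O -> qmul x y = (\bot)%O -> qmul x x = x.
Proof. by move=> xUy xy; rewrite -[RHS]qmul1 -xUy qmulUr xy joinx0. Qed.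

End QuantaleIdeals.

Theorem proposition6p1 (d : Order.disp_t) (Q : quantaleType d)
    (hJ : jacobson_radical Q = zero_ideal Q)
    (Sigma : set (set Q))
    (Sigma_proper : Sigma `<=` proper_ideal Q)
    (Sigma_max : maximal_ideal Q `<=` Sigma)
    (Sigma_disc : strongly_disconnects (quantale_subbasis Sigma)) :
  exists e : Q, [/\ qmul e e = e, e <> (\bot)%O & e <> (\top)%O].
Proof.
have [A [B [[[X sX <-] [Y sY <-]] [J1 [X0 XJ1]] [J2 [Y0 YJ2]] AUB AIB]]] :=
  Sigma_disc.
set I := \bigcap_(I in X) I in XJ1; set K := \bigcap_(I in Y) I in YJ2.
have iI : ideal Q I := ideal_bigcap _ sX.
have iK : ideal Q K := ideal_bigcap _ sY.
have properS (J : quantale_space Sigma) : ~ (set_val J) (\top)%O.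
  exact/proper_ideal_top/Sigma_proper/set_valP.
have pointS M : maximal_ideal Q M ->
    exists J : quantale_space Sigma, set_val J = M.
  by move=> /Sigma_max/mem_set SM; exists (exist _ M SM).
(* A maximal ideal above both [I] and [K] would be a point common to the two disjoint closed
   sets. *)
have [M /pointS[J <-] IJ KJ|x [y [Ix Ky xUy]]] := comaximal_ideals I K iI iK.
  by have : (uparrow Sigma X `&` uparrow Sigma Y) J by []; rewrite AIB.
have xy0 : qmul x y = (\bot)%O.
  suff : jacobson_radical Q (qmul x y) by rewrite hJ.
  move=> M /pointS[J <-].
  have [_ _ Idown] := iI; have [_ _ Kdown] := iK.
  have : (uparrow Sigma X `|` uparrow Sigma Y) J by rewrite AUB.
  case=> -[_]; apply.
  - exact: Idown Ix (qmul_lel x y).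
  - exact: Kdown Ky (qmul_ler x y).
exists x; split; first exact: complemented_idempotent xUy xy0.
(* Non-triviality comes from the points [J1] and [J2] of the two closed sets: [x = \bot] gives
   [y = \top] in [K], hence in [J2], while [x = \top] lies in [I], hence in [J1]; both ideals are
   proper. *)
- move=> x0; apply: (properS J2); apply: YJ2.
  by rewrite -xUy x0 join0x.
- by move=> x1; apply: (properS J1); apply: XJ1; rewrite -x1.
Qed.
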